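(* Let $\mathfrak{g}$ be the 4-dimensional real Lie algebra with basis $\{e_1,e_2,e_3,e_4\}$ whose nonzero brackets of basis vectors are determined (up to antisymmetry) by $$[e_4,e_1]=e_1,\qquad [e_4,e_2]=e_2,\qquad [e_4,e_3]=e_3,$$ and let $(G,H,g)$, $H=(J_1,J_2,J_3)$, be the corresponding Lie group equipped with the standard left-invariant structure $(J_1,J_2,J_3,g)$ described in the context. Then $(G,H,g)$ belongs to the class $\mathcal{W}^0$ of the (locally) conformally equivalent $\mathcal{K}$-manifolds; that is, it belongs to $\mathcal{W}=\mathcal{W}_4(J_1)\cap\mathcal{W}_1(J_2)\cap\mathcal{W}_1(J_3)$ and $\mathrm{d}(\theta_1\circ J_1)=0$.
   Context: Standard structure: given a 4-dimensional real Lie algebra $\mathfrak{g}$ with a fixed basis $\{e_1,e_2,e_3,e_4\}$, let $G$ be the simply connected Lie group with Lie algebra $\mathfrak{g}$, and regard elements of $\mathfrak{g}$ as left-invariant vector fields on $G$. Define left-invariant endomorphisms $$J_1e_1=e_2,\ J_1e_2=-e_1,\ J_1e_3=-e_4,\ J_1e_4=e_3;$$ $$J_2e_1=e_3,\ J_2e_2=e_4,\ J_2e_3=-e_1,\ J_2e_4=-e_2;$$ $$J_3e_1=-e_4,\ J_3e_2=e_3,\ J_3e_3=-e_2,\ J_3e_4=e_1,$$ and the left-invariant neutral metric $g$ with $g(x,y)=x^1y^1+x^2y^2-x^3y^3-x^4y^4$ for $x=\sum x^ie_i$, $y=\sum y^ie_i$. Then $g(x,y)=\varepsilon_\alpha g(J_\alpha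 x,J_\alpha y)$ with $\varepsilon_1=1$, $\varepsilon_2=\varepsilon_3=-1$. Structure tensors: let $\nabla$ be the Levi-Civita connection of $g$. For $\alpha=1,2,3$ put $F_\alpha(x,y,z)=g((\nabla_xJ_\alpha)y,z)$ and $\theta_\alpha(z)=g^{ij}F_\alpha(e_i,e_j,z)$, where $(g^{ij})$ is the inverse matrix of $(g(e_i,e_j))$ (summation convention). Classes (dimension 4; conditions are for all $x,y,z$): - $\mathcal{K}$: $\nabla J_\alpha=0$ for all $\alpha=1,2,3$. - $\mathcal{W}_4(J_1)$: $F_1(x,y,z)=\frac12\{g(x,y)\theta_1(z)-g(x,z)\theta_1(y)-g(x,J_1y)\theta_1(J_1z)+g(x,J_1z)\theta_1(J_1y)\}$. - $\mathcal{W}_1(J_\alpha)$, $\alpha=2,3$: $F_\alpha(x,y,z)=\frac14\{g(x,y)\theta_\alpha(z)+g(x,z)\theta_\alpha(y)+g(x,J_\alpha y)\theta_\alpha(J_\alpha z)+g(x,J_\alpha z)\theta_\alpha(J_\alpha y)\}$. - $\mathcal{W}=\mathcal{W}_4(J_1)\cap\mathcal{W}_1(J_2)\cap\mathcal{W}_1(J_3)$, and $\mathcal{W}^0=\{\mathcal{W}\mid \mathrm{d}(\theta_1\circ J_1)=0\}$ is the subclass of $\mathcal{W}$ on which the 1-form $\theta_1\circ J_1$ is closed; it is the class of manifolds (locally) conformally equivalent to $\mathcal{K}$-manifolds, where a conformal transformation of the metric is $\bar g=e^{2u}g$ for a differentiable function $u$. *)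

(* Defs.v *)
From HB Require Import structures.
From mathcomp Require Import all_boot all_order all_algebra.
From mathcomp Require Import all_classical reals topology normedtype landau derive.

Set Implicit Arguments.
Unset Strict Implicit.
Unset Printing Implicit Defensive.

Import Order.TTheory GRing.Theory Num.Theory.
Import numFieldNormedType.Exports.
Local Open Scope classical_set_scope.
Local Open Scope ring_scope.

(* [diffn k U f]: [f] and its iterated directional derivatives of order <= k
   are (Frechet) differentiable at every point of [U].  For [U] open in a
   finite-dimensional space, this for all [k] is being C^oo on [U]. *)
Fixpoint diffn (R : realType) (V W : normedModType R) (k : nat) (U : set V)
    (f : V -> W) : Prop :=
  (forall x, U x -> differentiable f x) /\
  (if k is k'.+1 then forall v : V, diffn k' U (fun x => 'D_v f x) else True).

Definition smooth_on (R : realType) (V W : normedModType R) (U : set V)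
    (f : V -> W) : Prop :=
  forall k, diffn k U f.

Section SmoothOnTheory.
Variables (R : realType) (V : normedModType R) (U : set V).
Hypothesis openU : open U.

Lemma near_eq_differentiable (W : normedModType R) (f g : V -> W) (x : V) :
  (\near x, f x = g x) -> differentiable f x -> differentiable g x.
Proof.
move=> fg df; have [cdf /eqaddoP fE] := (diff_locallyP _ _).1 df.
have gE : g \o shift x = cst (g x) + 'd f x +o_ 0 id.
  apply/eqaddoP => eps e0; have := fE _ e0.
  have fg0 : \forall h \near (0 : V), f (h + x) = g (h + x).
    move: fg; rewrite (near_shift 0 x) /=.
    by apply: filterS => h; rewrite subr0.
  apply: filterS2 fg0 => h fgh.
  by rewrite /= !fctE /= /cst -(nbhs_singleton fg) fgh.
by apply/diff_locallyP; rewrite (diff_unique cdf gE).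
Qed.

Lemma diffn_eq (W : normedModType R) k (f g : V -> W) :
  (forall x, U x -> f x = g x) -> diffn k U f -> diffn k U g.
Proof.
have fgn (f' g' : V -> W) x : (forall x, U x -> f' x = g' x) -> U x ->
    \near x, f' x = g' x.
  by move=> fg Ux; apply: filterS (open_nbhs_nbhs (conj openU Ux)).
elim: k f g => [|k IH] f g fg /= [df Df]; split=> //.
- by move=> x Ux; apply: near_eq_differentiable (df _ Ux); apply: fgn.
- by move=> x Ux; apply: near_eq_differentiable (df _ Ux); apply: fgn.
- move=> v; apply: IH (Df v) => x Ux.
  by apply: near_eq_derive; apply: fgn.
Qed.

Lemma diffnW (W : normedModType R) k (f : V -> W) :
  diffn k.+1 U f -> diffn k U f.
Proof.
elim: k f => [|k IH] f [df Df]; split=> // v.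
by apply: IH; apply: Df.
Qed.

Lemma smooth_on_cst (W : normedModType R) (a : W) : smooth_on U (fun=> a).
Proof.
suff H k b : diffn k U (cst b : V -> W) by move=> k; apply: H.
elim: k b => [|k IH] b; split=> //; try by move=> x _; exact: differentiable_cst.
move=> v; have -> : (fun x => 'D_v (cst b) x) = cst (0 : W) :> (V -> W).
  by apply/funext => x; rewrite derive_cst.
exact: IH.
Qed.

Lemma diffnD (W : normedModType R) k (f g : V -> W) :
  diffn k U f -> diffn k U g -> diffn k U (f + g).
Proof.
elim: k f g => [|k IH] f g [df Df] [dg Dg].
  split=> [x Ux|]; last exact: I.
  by apply: differentiableD; [apply: df|apply: dg].
split=> [x Ux|v]; first by apply: differentiableD; [apply: df|apply: dg].
apply: diffn_eq (IH _ _ (Df v) (Dg v)) => x Ux /=.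
by rewrite deriveD //; apply: diff_derivable; [apply: df|apply: dg].
Qed.

Lemma diffnM k (f g : V -> R) :
  diffn k U f -> diffn k U g -> diffn k U (f * g).
Proof.
elim: k f g => [|k IH] f g sf sg.
  split=> // x Ux; case: sf => df _; case: sg => dg _.
  by apply: differentiableM; [apply: df|apply: dg].
have [[df Df] [dg Dg]] := (sf, sg).
split=> [x Ux|v].
  by apply: differentiableM; [apply: df|apply: dg].
apply: diffn_eq (diffnD (IH _ _ (diffnW sf) (Dg v)) (IH _ _ (diffnW sg) (Df v))).
move=> x Ux /=.
by rewrite deriveM //; apply: diff_derivable; [apply: df|apply: dg].
Qed.

End SmoothOnTheory.

(* Local charts of a topological space modelled on R^n: a homeomorphism
   [phi] from the open set [dom] onto an open subset of R^n, with inverse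
   [psi]; the values of [phi] and [psi] elsewhere are irrelevant. *)
Record chart (R : realType) (n : nat) (M : topologicalType) := Chart {
  dom : set M;
  phi : M -> 'rV[R]_n;
  psi : 'rV[R]_n -> M;
  dom_open : open dom;
  img_open : open (phi @` dom);
  phiK : forall p, dom p -> psi (phi p) = p;
  phi_cont : forall p, dom p -> {for p, continuous phi};
  psi_cont : forall x, (phi @` dom) x -> {for x, continuous psi} }.

Arguments dom_open {R n M} c.
Arguments img_open {R n M} c.

(* The atlas is not required to be maximal. *)
Record manifold (R : realType) (n : nat) := Manifold {
  carrier :> topologicalType;
  atlas : set (chart R n carrier);
  manifold_hausdorff : hausdorff_space carrier;
  manifold_second_countable : @second_countable carrier;
  atlas_cover : forall p : carrier, exists2 c, atlas c & dom c p;
  atlas_compat : forall c d, atlas c -> atlas d ->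
    smooth_on (phi c @` (dom c `&` dom d)) (phi d \o psi c) }.

Definition smooth_map (R : realType) (m n : nat) (M : manifold R m)
    (N : manifold R n) (f : M -> N) : Prop :=
  continuous f /\
  forall c d, atlas c -> atlas d ->
    smooth_on (phi c @` (dom c `&` f @^-1` dom d)) (phi d \o f \o psi c).

(* Smoothness of a map of two variables, with respect to the product charts
   on M * M'. *)
Definition smooth_map2 (R : realType) (m m' n : nat) (M : manifold R m)
    (M' : manifold R m') (N : manifold R n) (f : M -> M' -> N) : Prop :=
  continuous (fun q : M * M' => f q.1 q.2) /\
  forall c c' d, atlas c -> atlas c' -> atlas d ->
    smooth_on
      [set x : 'rV[R]_m * 'rV[R]_m' |
        [/\ (phi c @` dom c) x.1, (phi c' @` dom c') x.2
          & dom d (f (psi c x.1) (psi c' x.2))]]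
      (fun x => phi d (f (psi c x.1) (psi c' x.2))).

Section SmoothFunctions.
Variables (R : realType) (n : nat) (M : manifold R n).

Definition smooth (f : M -> R) : Prop :=
  forall c, atlas c -> smooth_on (phi c @` dom c) (f \o psi c).

Definition smooth_pred : {pred M -> R} := [pred f | `[< smooth f >]].

Lemma smooth_subring : subring_closed smooth_pred.
Proof.
have smN f : smooth f -> smooth (- f).
  move=> sf c ac k; have -> : (- f) \o psi c = cst (-1) * (f \o psi c).
    by apply/funext => x; rewrite /= !fctE /= mulN1r.
  by apply: (diffnM (img_open c)); [exact: smooth_on_cst|exact: sf].
split=> [|f g /asboolP sf /asboolP sg|f g /asboolP sf /asboolP sg];
  apply/asboolP => c ac k.
- exact: smooth_on_cst.
- exact: (diffnD (img_open c) (sf c ac k) (smN _ sg c ac k)).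
- exact: (diffnM (img_open c) (sf c ac k) (sg c ac k)).
Qed.

HB.instance Definition _ := GRing.isSubringClosed.Build (M -> R)
  smooth_pred smooth_subring.

Lemma smooth_scaler : GRing.scaler_closed smooth_pred.
Proof.
move=> a f /asboolP sf; apply/asboolP => c ac k.
have -> : (a *: f) \o psi c = cst a * (f \o psi c) by [].
by apply: (diffnM (img_open c)); [exact: smooth_on_cst|exact: sf].
Qed.

HB.instance Definition _ := GRing.isScaleClosed.Build R (M -> R)
  smooth_pred smooth_scaler.

(* The commutative R-algebra C^oo(M). *)
Record cinf : Type := Cinf { cinf_fun :> M -> R; _ : cinf_fun \in smooth_pred }.

HB.instance Definition _ := [isSub for cinf_fun].
HB.instance Definition _ := [Choice of cinf by <:].
HB.instance Definition _ := 
  GRing.SubChoice_isSubComPzRing.Build _ _ cinf (GRing.subringClosedP _).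
HB.instance Definition _ := [SubZmodule_isSubLmodule of cinf by <:].

End SmoothFunctions.

(* Vector fields on M are the R-linear derivations of C^oo(M). *)
Section VectorFields.
Variables (R : realType) (n : nat) (M : manifold R n).
Local Notation C := (cinf M).

Record vfield : Type := VField {
  vf :> C -> C;
  vf_linear : forall (a : R) (f h : C), vf (a *: f + h) = a *: vf f + vf h;
  vf_leibniz : forall f h : C, vf (f * h) = vf f * h + f * vf h }.

Lemma vfieldP (X Y : vfield) : (forall f, X f = Y f) -> X = Y.
Proof.
case: X => X Xl XM; case: Y => Y Yl YM /= /funext XY.
by subst Y; congr VField; apply: Prop_irrelevance.
Qed.

Lemma cinfP (f h : C) : (forall p, f p = h p) -> f = h.
Proof. by move=> fh; apply: val_inj; apply/funext. Qed.

Let scalE (a : R) (f h : C) : a *: (f * h) = (a *: f) * h.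
Proof. by apply: cinfP => p; exact: mulrA. Qed.

Fact vf0_linear (a : R) (f h : C) : (0 : C) = a *: 0 + 0.
Proof. by rewrite scaler0 addr0. Qed.
Fact vf0_leibniz (f h : C) : (0 : C) = 0 * h + f * 0.
Proof. by rewrite mul0r mulr0 addr0. Qed.
Definition vf0 : vfield := VField vf0_linear vf0_leibniz.

Section Add.
Variables X Y : vfield.
Let D (f : C) := X f + Y f.
Fact vfD_linear (a : R) (f h : C) : D (a *: f + h) = a *: D f + D h.
Proof. by rewrite /D !vf_linear scalerDr addrACA. Qed.
Fact vfD_leibniz (f h : C) : D (f * h) = D f * h + f * D h.
Proof. by rewrite /D !vf_leibniz mulrDl mulrDr addrACA. Qed.
Definition vfD : vfield := VField vfD_linear vfD_leibniz.
End Add.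

Section Opp.
Variable X : vfield.
Let D (f : C) := - X f.
Fact vfN_linear (a : R) (f h : C) : D (a *: f + h) = a *: D f + D h.
Proof. by rewrite /D vf_linear opprD scalerN. Qed.
Fact vfN_leibniz (f h : C) : D (f * h) = D f * h + f * D h.
Proof. by rewrite /D vf_leibniz opprD mulNr mulrN. Qed.
Definition vfN : vfield := VField vfN_linear vfN_leibniz.
End Opp.

Section Scale.
Variables (k : C) (X : vfield).
Let D (f : C) := k * X f.
Fact vfZ_linear (a : R) (f h : C) : D (a *: f + h) = a *: D f + D h.
Proof. by rewrite /D vf_linear mulrDr mulrC -scalE [X f * k]mulrC. Qed.
Fact vfZ_leibniz (f h : C) : D (f * h) = D f * h + f * D h.
Proof. by rewrite /D vf_leibniz mulrDr !mulrA [k * f]mulrC. Qed.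
Definition vfZ : vfield := VField vfZ_linear vfZ_leibniz.
End Scale.

Section Bracket.
Variables X Y : vfield.
Let D (f : C) := X (Y f) - Y (X f).
Fact vfB_linear (a : R) (f h : C) : D (a *: f + h) = a *: D f + D h.
Proof. by rewrite /D !vf_linear opprD addrACA scalerBr. Qed.
Fact vfB_leibniz (f h : C) : D (f * h) = D f * h + f * D h.
Proof.
have vD (Z : vfield) (u v : C) : Z (u + v) = Z u + Z v.
  by have := vf_linear Z 1 u v; rewrite !scale1r.
rewrite /D !vf_leibniz !vD !vf_leibniz mulrBl mulrBr.
set A := X (Y f) * h; set B := Y f * X h; set E := X f * Y h.
set F := f * X (Y h); set A' := Y (X f) * h; set F' := f * Y (X h).
rewrite (addrACA A') opprD addrACA [A' + B]addrC addrKA.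
by rewrite [E + F]addrC addrKA.
Qed.
Definition lie_bracket : vfield := VField vfB_linear vfB_leibniz.
End Bracket.

HB.instance Definition _ := gen_eqMixin vfield.
HB.instance Definition _ := gen_choiceMixin vfield.

Fact vfDA : associative vfD.
Proof. by move=> X Y Z; apply: vfieldP => f; exact: addrA. Qed.
Fact vfDC : commutative vfD.
Proof. by move=> X Y; apply: vfieldP => f; exact: addrC. Qed.
Fact vfD0 : left_id vf0 vfD.
Proof. by move=> X; apply: vfieldP => f; exact: add0r. Qed.
Fact vfDN : left_inverse vf0 vfN vfD.
Proof. by move=> X; apply: vfieldP => f; exact: addNr. Qed.

HB.instance Definition _ := GRing.isZmodule.Build vfield vfDA vfDC vfD0 vfDN.

Fact vfZA (k l : C) (X : vfield) : vfZ k (vfZ l X) = vfZ (k * l) X.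
Proof. by apply: vfieldP => f; exact: mulrA. Qed.
Fact vfZ1 : left_id 1 vfZ.
Proof. by move=> X; apply: vfieldP => f; exact: mul1r. Qed.
Fact vfZDr : right_distributive vfZ +%R.
Proof. by move=> k X Y; apply: vfieldP => f; exact: mulrDr. Qed.
Fact vfZDl (X : vfield) : {morph vfZ^~ X : k l / k + l}.
Proof. by move=> k l; apply: vfieldP => f; exact: mulrDl. Qed.

HB.instance Definition _ :=
  GRing.Zmodule_isLmodule.Build C vfield vfZA vfZ1 vfZDr vfZDl.

(* Tangent vectors at [p], as derivations of C^oo(M) at [p]. *)
Definition tangent (p : M) (v : C -> R) : Prop :=
  (forall (a : R) (f h : C), v (a *: f + h) = a * v f + v h) /\
  (forall f h : C, v (f * h) = v f * h p + f p * v h).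

End VectorFields.

(* Path-connected with trivial fundamental group: every loop is homotopic,
   relatively to its endpoints, to a constant loop. *)
Definition simply_connected (R : realType) (T : topologicalType) : Prop :=
  (forall x y : T, exists c : R -> T,
     [/\ {within `[0, 1]%classic, continuous c}, c 0 = x & c 1 = y]) /\
  (forall c : R -> T, {within `[0, 1]%classic, continuous c} -> c 0 = c 1 ->
     exists H : R * R -> T,
       [/\ {within `[0, 1]%classic `*` `[0, 1]%classic, continuous H},
           (forall s, s \in `[0, 1] -> H (s, 0) = c s /\ H (s, 1) = c 0)
         & (forall t, t \in `[0, 1] -> H (0, t) = c 0 /\ H (1, t) = c 0)]).

Record lieGroup (R : realType) (n : nat) := LieGroup {
  lie_manifold :> manifold R n;
  lmul : lie_manifold -> lie_manifold -> lie_manifold;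
  linv : lie_manifold -> lie_manifold;
  lone : lie_manifold;
  lmulA : associative lmul;
  lmul1g : left_id lone lmul;
  lmulVg : left_inverse lone linv lmul;
  lmul_smooth : smooth_map2 lmul;
  linv_smooth : smooth_map linv }.

Arguments lone {R n} l.

Section LeftInvariant.
Variables (R : realType) (n : nat) (G : lieGroup R n).

(* X (f o L_a) = (X f) o L_a, where L_a is the left translation by [a] and
   [h] is f o L_a as an element of C^oo(G). *)
Definition left_invariant (X : vfield G) : Prop :=
  forall (a : G) (f h : cinf G), (forall p, h p = f (lmul a p)) ->
  forall p, X h p = X f (lmul a p).

(* [e] is a basis of the Lie algebra of G, i.e. the [e i] are left-invariant
   and their values at the identity form a basis of the tangent space there. *)
Definition lie_algebra_basis (m : nat) (e : 'I_m -> vfield G) : Prop :=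
  (forall i, left_invariant (e i)) /\
  (forall v : cinf G -> R, tangent (lone G) v ->
     exists! c : 'rV[R]_m, forall f, v f = \sum_i c 0 i * e i f (lone G)).

End LeftInvariant.

(* Tensor fields are maps that are multilinear over C^oo(M). *)
Section Tensors.
Variables (R : realType) (n : nat) (M : manifold R n).
Local Notation C := (cinf M).
Local Notation X := (vfield M).

Definition symmetric_tensor (g : X -> X -> C) : Prop :=
  (forall x y, g x y = g y x) /\
  (forall (f : C) x y z, g (f *: x + y) z = f * g x z + g y z).

Definition affine_connection (nabla : X -> X -> X) : Prop :=
  [/\ forall (f : C) x y z, nabla (f *: x + y) z = f *: nabla x z + nabla y z,
      forall x y z, nabla x (y + z) = nabla x y + nabla x z
    & forall (f : C) (x y : X), nabla x (f *: y) = x f *: y + f *: nabla x y].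

Definition levi_civita (g : X -> X -> C) (nabla : X -> X -> X) : Prop :=
  [/\ affine_connection nabla,
      forall x y, nabla x y - nabla y x = lie_bracket x y
    & forall x y z : X, x (g y z) = g (nabla x y) z + g y (nabla x z)].

(* F(x, y, z) = g ((nabla_x J) y, z) *)
Definition Ften (g : X -> X -> C) (nabla : X -> X -> X) (J : X -> X)
    (x y z : X) : C :=
  g (nabla x (J y) - J (nabla x y)) z.

(* d omega, without the factor 1/2 used by some authors. *)
Definition dform (omega : X -> C) (x y : X) : C :=
  x (omega y) - y (omega x) - omega (lie_bracket x y).

End Tensors.

Section Classes.
Variables (R : realType) (G : lieGroup R 4) (e : 'I_4 -> vfield G).
Variables (g : vfield G -> vfield G -> cinf G).
Variables (nabla : vfield G -> vfield G -> vfield G).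

(* The matrix of the g(e_i, e_j); these are constant functions when [g] and
   the [e i] are left-invariant. *)
Definition gram : 'M[R]_4 := \matrix_(i, j) g (e i) (e j) (lone G).

Definition theta (J : vfield G -> vfield G) (z : vfield G) : cinf G :=
  \sum_i \sum_j invmx gram i j *: Ften g nabla J (e i) (e j) z.

Definition class_W4 (J : vfield G -> vfield G) : Prop :=
  forall x y z, Ften g nabla J x y z =
    (2^-1 : R) *: (g x y * theta J z - g x z * theta J y
                 - g x (J y) * theta J (J z) + g x (J z) * theta J (J y)).

Definition class_W1 (J : vfield G -> vfield G) : Prop :=
  forall x y z, Ften g nabla J x y z =
    (4^-1 : R) *: (g x y * theta J z + g x z * theta J y
                 + g x (J y) * theta J (J z) + g x (J z) * theta J (J y)).

Definition class_W (J1 J2 J3 : vfield G -> vfield G) : Prop :=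
  [/\ class_W4 J1, class_W1 J2 & class_W1 J3].

Definition class_W0 (J1 J2 J3 : vfield G -> vfield G) : Prop :=
  class_W J1 J2 J3 /\ forall x y, dform (theta J1 \o J1) x y = 0.

End Classes.

Section StandardStructure.
Variables (R : realType) (G : lieGroup R 4) (e1 e2 e3 e4 : vfield G).

Definition frame (i : 'I_4) : vfield G := tnth [tuple e1; e2; e3; e4] i.

Definition standard_J1 (J : {linear vfield G -> vfield G}) : Prop :=
  [/\ J e1 = e2, J e2 = - e1, J e3 = - e4 & J e4 = e3].

Definition standard_J2 (J : {linear vfield G -> vfield G}) : Prop :=
  [/\ J e1 = e3, J e2 = e4, J e3 = - e1 & J e4 = - e2].

Definition standard_J3 (J : {linear vfield G -> vfield G}) : Prop :=
  [/\ J e1 = - e4, J e2 = e3, J e3 = - e2 & J e4 = e1].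

(* g(x, y) = x^1 y^1 + x^2 y^2 - x^3 y^3 - x^4 y^4 *)
Definition standard_metric (g : vfield G -> vfield G -> cinf G) : Prop :=
  symmetric_tensor g /\
  forall x y : 'I_4 -> cinf G,
    g (\sum_i x i *: frame i) (\sum_i y i *: frame i) =
    x 0 * y 0 + x 1 * y 1 - x 2 * y 2 - x 3 * y 3.

End StandardStructure.

(* Main.v *)
(* Write t(x) = - g(e4, x).  On the frame [x, y] = t(x) y - t(y) x, so Koszul's
   formula gives nabla_x y = g(e4, y) x - g(x, y) e4 and hence, for every J,
     F_J(x, y, z) = g(e4, Jy) g(x, z) - g(x, Jy) g(e4, z)
                    - g(e4, y) g(Jx, z) + g(x, y) g(J e4, z).
   If g(Jx, y) = s g(x, Jy) with s = 1 or s = -1, taking the trace yields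
   theta_J(z) = (3 + s) g(J e4, z), and the conditions W4 (s = -1) and W1
   (s = 1) become identities.  Finally theta_1 (J_1 z) = 2 g(e4, z), which is
   closed because nabla_x e4 = - x - g(x, e4) e4 is g-self-adjoint in x.

   The classes quantify over all vector fields, so one needs that a basis of
   the Lie algebra spans the derivations of C^oo(G) over C^oo(G).  Left
   translation gives pointwise coordinates; Cramer's rule, applied with
   functions f_j such that the matrix (e_i f_j) is invertible at a given point,
   makes a nonzero multiple of them globally smooth, which is enough to see
   that g is nondegenerate and then that x = sum_i eps_i g(x, e_i) e_i. *)
Require Import Defs.
From HB Require Import structures.
From mathcomp Require Import all_boot all_order all_algebra.
From mathcomp Require Import all_classical reals topology normedtype landau derive.
From mathcomp Require Import ring.

Set Implicit Arguments.
Unset Strict Implicit.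
Unset Printing Implicit Defensive.

Import Order.TTheory GRing.Theory Num.Theory.
Import numFieldNormedType.Exports.
Local Open Scope classical_set_scope.
Local Open Scope ring_scope.

(** * Calculus of iterated differentiability: locality, chain rule, slices *)

Section SmoothOn.
Variable R : realType.

Lemma diffnS (V W : normedModType R) k (U U' : set V) (f : V -> W) :
  U `<=` U' -> diffn k U' f -> diffn k U f.
Proof.
move=> UU'; elim: k f => [|k IH] f [df Df]; (split; first by move=> x /UU' /df).
  by [].
by move=> v; apply/IH/Df.
Qed.

(** [diffn] is a pointwise condition on a total function, so the sets [U'] need not be open; this
    allows a different choice of charts around each point. *)
Lemma diffn_local (V W : normedModType R) k (U : set V) (f : V -> W) :
  (forall x, U x -> exists2 U', U' x & diffn k U' f) -> diffn k U f.
Proof.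
elim: k f => [|k IH] f loc; (split; first by move=> x /loc [U' U'x [/(_ x U'x)]]).
  by [].
by move=> v; apply: IH => x /loc [U' U'x [_ /(_ v)]]; exists U'.
Qed.

Lemma diffn_sum (V W : normedModType R) n k (U : set V) (f : 'I_n -> V -> W) :
  open U -> (forall i, diffn k U (f i)) -> diffn k U (\sum_i f i).
Proof.
move=> oU df; elim/big_ind: _ => // [|g h]; first exact: smooth_on_cst.
exact: diffnD.
Qed.

Lemma diffn_coord (V : normedModType R) n k (U : set V) (f : V -> 'rV[R]_n) j :
  open U -> diffn k U f -> diffn k U (fun x => f x 0 j).
Proof.
have dcoord (h : V -> 'rV[R]_n) x :
    differentiable h x -> differentiable (fun x => h x 0 j) x.
  move=> dh.
  exact: (differentiable_comp dh (differentiable_coord (h x) 0 j)).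
move=> oU; elim: k f => [|k IH] f [df Df]; (split; first by move=> x /df/dcoord).
  by [].
move=> v; apply: (diffn_eq oU _ (IH _ (Df v))) => x Ux.
by rewrite derive_mx ?mxE//; apply/diff_derivable/df.
Qed.

Lemma derive_comp_row (V : normedModType R) n (f : 'rV[R]_n -> R)
    (g : V -> 'rV[R]_n) (v x : V) :
  differentiable g x -> differentiable f (g x) ->
  'D_v (f \o g) x = \sum_j 'D_v g x 0 j * 'D_(delta_mx 0 j) f (g x).
Proof.
move=> dg df; rewrite deriveE; last exact: differentiable_comp.
rewrite diff_comp//= -(deriveE v dg) [X in 'd f _ X]row_sum_delta linear_sum.
by apply: eq_bigr => j _; rewrite linearZ/= -(deriveE _ df).
Qed.

(** By the chain rule a derivative of [f \o g] is a sum of products of coordinates of ['D_v g] with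
    partial derivatives of [f] composed with [g]. Induction on [k] applies to the latter, since only
    [f] has changed. *)
Lemma diffn_comp (V : normedModType R) n k (U : set V) (U' : set 'rV[R]_n)
    (f : 'rV[R]_n -> R) (g : V -> 'rV[R]_n) :
  open U -> (forall x, U x -> U' (g x)) ->
  diffn k U g -> diffn k U' f -> diffn k U (f \o g).
Proof.
move=> oU UU'; elim: k f => [|k IH] f dg df.
  case: dg df => dg _ [df _]; split=> // x Ux.
  by apply: differentiable_comp; [exact: dg|exact/df/UU'].
have [dg0 dg1] := dg; have [df0 df1] := df.
split=> [x Ux|v]; first by apply: differentiable_comp; [exact: dg0|exact/df0/UU'].
pose h := \sum_j (fun x => 'D_v g x 0 j) * ('D_(delta_mx 0 j) f \o g).
have dh : diffn k U h.
  apply: diffn_sum => // j; apply: diffnM => //; first exact/diffn_coord/dg1.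
  by apply: IH; [exact: diffnW|exact: df1].
apply: (diffn_eq oU _ dh) => x Ux.
by rewrite derive_comp_row; [rewrite /h fct_sumE|exact: dg0|exact/df0/UU'].
Qed.

Lemma diffn_slice (V V' W : normedModType R) k (U : set (V * V')) (a : V)
    (f : V * V' -> W) :
  diffn k U f -> diffn k [set x | U (a, x)] (fun x => f (a, x)).
Proof.
have dslice (h : V * V' -> W) x :
    differentiable h (a, x) -> differentiable (fun x => h (a, x)) x.
  move=> dh.
  have dp : differentiable (fun x => (a, x)) x by exact: differentiable_pair.
  exact: (differentiable_comp dp dh).
elim: k f => [|k IH] f [df Df]; (split; first by move=> x /df/dslice).
  by [].
(* The two difference quotients coincide, so the equality holds at every [x], whether or not [f] is
   differentiable there. *)
move=> v; have -> : (fun x => 'D_v (fun y => f (a, y)) x)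
    = (fun x => 'D_(0, v) f (a, x)).
  apply/funext => x; apply: (congr1 (fun F : R -> W => lim (F @ 0^'))).
  apply/funext => h; congr (_ *: (f _ - _)); congr pair.
  by rewrite /= scaler0 add0r.
exact: (IH _ (Df (0, v))).
Qed.

End SmoothOn.

(** * Left translation of functions and of tangent vectors *)

Section LieGroup.
Variables (R : realType) (n : nat) (G : lieGroup R n).
Implicit Types (a p : G) (f : cinf G).

Lemma lmulgV a : lmul a (linv a) = lone G.
Proof.
rewrite -[LHS]lmul1g -(lmulVg (linv a)) -lmulA [lmul (linv a) (lmul _ _)]lmulA.
by rewrite lmulVg lmul1g lmulVg.
Qed.

Lemma lmulg1 a : lmul a (lone G) = a.
Proof. by rewrite -(lmulVg a) lmulA lmulgV lmul1g. Qed.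

Lemma lmul_continuous a : continuous (lmul a).
Proof.
move=> p; have [cm _] := lmul_smooth G.
have cp : (fun q : G => (a, q)) @ p --> (a, p) by apply: cvg_pair => //; exact: cvg_cst.
exact: (cvg_comp _ _ cp (cm (a, p))).
Qed.

Lemma cinf_smooth f : smooth f.
Proof. by case: f => f /= /asboolP. Qed.

Lemma smooth_translate a f : smooth (f \o lmul a).
Proof.
move=> c ac k; apply: diffn_local => x imgx.
have [d ad dd] := atlas_cover (lmul a (psi c x)).
have [c0 ac0 dc0] := atlas_cover a.
pose U := [set y | (phi c @` dom c) y /\ dom d (lmul a (psi c y))].
have oU : open U.
  rewrite openE => y [imgy dy]; apply: filterI.
    exact: (open_nbhs_nbhs (conj (img_open c) imgy)).
  apply: (cvg_comp _ _ (psi_cont imgy) (@lmul_continuous a (psi c y))).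
  exact: (open_nbhs_nbhs (conj (dom_open d) dy)).
exists U => //.
(* Writing [a] as [psi c0 (phi c0 a)] makes [F] a slice of the chart expression of the
   multiplication; on [U] the translate is [f \o psi d] composed with [F]. *)
pose F y := phi d (lmul (psi c0 (phi c0 a)) (psi c y)).
have dF : diffn k U F.
  have [_ /(_ c0 c d ac0 ac ad k) sm] := lmul_smooth G.
  apply: diffnS (diffn_slice (phi c0 a) sm) => y [imgy dy].
  by split=> //=; [exists a|rewrite phiK].
have UF y : U y -> (phi d @` dom d) (F y).
  by move=> [_ dy]; exists (lmul a (psi c y)); rewrite // /F phiK.
apply: (diffn_eq oU _ (diffn_comp oU UF dF (cinf_smooth f ad k))) => y [_ dy].
by rewrite /F /= phiK // phiK.
Qed.

Definition translate a f : cinf G := Cinf (introT (asboolP _) (smooth_translate a f)).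

Lemma translateE a f p : translate a f p = f (lmul a p).
Proof. by []. Qed.

Lemma left_invariantE (X : vfield G) a f p :
  left_invariant X -> X (translate a f) p = X f (lmul a p).
Proof. by move=> /(_ a f (translate a f)); apply. Qed.

(** Moving the value of [X] at [p] to the identity makes the basis hypothesis, stated at [lone G],
    available at every point. *)
Lemma tangent_translate (X : vfield G) p :
  tangent (lone G) (fun f => X (translate (linv p) f) p).
Proof.
split=> [b f h|f h].
  have -> : translate (linv p) (b *: f + h)
    = b *: translate (linv p) f + translate (linv p) h by exact: cinfP.
  by rewrite vf_linear.
have -> : translate (linv p) (f * h) = translate (linv p) f * translate (linv p) h.
  exact: cinfP.
by rewrite vf_leibniz -(lmulVg p).
Qed.

Lemma translateK a f : translate (linv a) (translate a f) = f.
Proof. by apply: cinfP => p; rewrite !translateE lmulA lmulgV lmul1g. Qed.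

Section Basis.
Variables (m : nat) (e : 'I_m -> vfield G).
Hypothesis basis_e : lie_algebra_basis e.

Lemma pointwise_coordinates (X : vfield G) p :
  exists c : 'rV[R]_m, forall f, X f p = \sum_i c 0 i * e i f p.
Proof.
have [inv_e /(_ _ (tangent_translate X p)) [c [cE _]]] := basis_e.
exists c => f; rewrite -[in LHS](translateK p f) cE.
by apply: eq_bigr => i _; rewrite left_invariantE // lmulg1.
Qed.

End Basis.
End LieGroup.

(** Greedy choice: as long as fewer than [n] rows are chosen, a nonzero column [c] is killed by all
    of them; some [u t] does not kill [c], hence is independent of the rows already chosen. *)
Lemma separating_unitmx (K : fieldType) (T : Type) n (u : T -> 'rV[K]_n) :
  (forall c : 'cV_n, (forall t, u t *m c = 0) -> c = 0) ->
  exists F : 'I_n -> T, \matrix_i u (F i) \in unitmx.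
Proof.
move=> sep.
suff free k : (k <= n)%N -> exists F : 'I_k -> T, row_free (\matrix_i u (F i)).
  by have [F] := free n (leqnn n); rewrite row_free_unit; exists F.
elim: k => [_|k IH ltkn].
  have F : 'I_0 -> T by case.
  by exists F; apply: inj_row_free => v _; rewrite thinmx0.
have [F freeF] := IH (ltnW ltkn); set M := (X in row_free X) in freeF.
have [j cj] : exists j, col j (cokermx M) != 0.
  apply/existsP; apply: contraT => /existsPn c0.
  suff : cokermx M == 0.
    by rewrite cokermx_eq0 -col_leq_rank leqNgt (leq_ltn_trans (rank_leq_row M) ltkn).
  apply/eqP/matrixP => i j; have /negbNE/eqP/colP/(_ i) := c0 j.
  by rewrite !mxE.
set c := col j _ in cj.
have Mc i : u (F i) *m c = 0.
  rewrite -[u _](rowK (fun i => u (F i))) /c colE mulmxA -row_mul.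
  by rewrite mulmx_coker row0 mul0mx.
have [t tc] : exists t, u t *m c <> 0.
  by apply/existsNP => uc; move/eqP: cj; apply; apply: sep.
exists (fun i => oapp F t (unlift ord0 i)).
apply: inj_row_free => v; rewrite mulmx_sum_row big_ord_recl rowK unlift_none /=.
under eq_bigr do rewrite rowK liftK /=.
(* Multiplying the relation by [c] kills the old rows and isolates the coefficient of the new
   one. *)
move=> v0; have v00 : v 0 ord0 = 0.
  have /eqP := congr1 (mulmx^~ c) v0; rewrite /= mul0mx mulmxDl mulmx_suml.
  rewrite big1 => [|i _]; last by rewrite -scalemxAl Mc scaler0.
  by rewrite addr0 -scalemxAl scaler_eq0 => /orP[/eqP//|/eqP].
move: v0; rewrite v00 scale0r add0r => v0.
have w0 : \row_i v 0 (lift ord0 i) = 0.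
  apply: (row_free_inj freeF); rewrite mul0mx mulmx_sum_row -[RHS]v0.
  by apply: eq_bigr => i _; rewrite mxE rowK.
apply/rowP => i; rewrite mxE; case: (unliftP ord0 i) => [j' ->|->//].
by have /rowP/(_ j') := w0; rewrite !mxE.
Qed.

Section Evaluation.
Variables (R : realType) (n : nat) (M : manifold R n).

(** Named so as to carry a ring morphism structure, by which determinants and adjugates over C^oo(M)
    are evaluated entrywise. *)
Definition cinf_eval (p : M) (f : cinf M) : R := f p.

Fact cinf_eval_zmod_morphism p : zmod_morphism (cinf_eval p). Proof. by []. Qed.
Fact cinf_eval_monoid_morphism p : monoid_morphism (cinf_eval p). Proof. by []. Qed.

HB.instance Definition _ p := GRing.isZmodMorphism.Build (cinf M) R (cinf_eval p)
  (cinf_eval_zmod_morphism p).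
HB.instance Definition _ p := GRing.isMonoidMorphism.Build (cinf M) R (cinf_eval p)
  (cinf_eval_monoid_morphism p).

End Evaluation.

Lemma vfield_sumE (R : realType) (n : nat) (M : manifold R n) (I : finType)
    (k : I -> cinf M) (X : I -> vfield M) f p :
  (\sum_i k i *: X i) f p = \sum_i k i p * X i f p.
Proof.
by apply: (big_morph (fun Y : vfield M => Y f p)).
Qed.

(** * Smooth coordinates in a left-invariant frame by Cramer's rule *)

Section Frame.
Variables (R : realType) (n : nat) (G : lieGroup R n).
Variables (m : nat) (e : 'I_m -> vfield G).
Hypothesis basis_e : lie_algebra_basis e.

Definition frame_derivatives (F : 'I_m -> cinf G) : 'M[cinf G]_m :=
  \matrix_(i, j) e i (F j).

(** Uniqueness of the coordinates of the zero vector is independence of the [e i] at the identity,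
    so [separating_unitmx] yields functions there; translation by [linv p] carries them to [p]. *)
Lemma locally_dual_functions (p : G) :
  exists F, map_mx (cinf_eval p) (frame_derivatives F) \in unitmx.
Proof.
have [inv_e coord_e] := basis_e.
have [|F unitF] := @separating_unitmx _ (cinf G) m (fun f => \row_i e i f (lone G)).
  move=> c c0; pose z (f : cinf G) : R := 0.
  have [|d [dE duniq]] := coord_e z.
    by split=> [a f h|f h]; rewrite /z ?mulr0 ?mul0r addr0.
  have z0 (b : 'rV[R]_m) : (forall f, z f = \sum_i b 0 i * e i f (lone G)) -> b = 0.
    move=> /duniq <-; apply: duniq => f.
    by rewrite big1 // => i _; rewrite mxE mul0r.
  apply: trmx_inj; rewrite trmx0; apply: z0 => f; have /matrixP/(_ 0 0) := c0 f.
  rewrite !mxE => uc; rewrite -[LHS]uc; apply: eq_bigr => i _.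
  by rewrite !mxE mulrC.
exists (fun j => translate (linv p) (F j)).
(* Functions index columns here and rows in [separating_unitmx]. *)
rewrite -unitmx_tr; congr (_ \in unitmx): unitF.
by apply/matrixP => i j; rewrite !mxE /cinf_eval left_invariantE // lmulVg.
Qed.

(** At each point the row of the [X (F j)] is the coordinate row of [X] times the matrix, and the
    adjugate turns this into the determinant times the coordinates. Nothing is divided, so zeros of
    the determinant do no harm. *)
Lemma cramer_coordinates (X : vfield G) F :
  \det (frame_derivatives F) *: X =
  \sum_i (\row_j X (F j) *m \adj (frame_derivatives F)) 0 i *: e i.
Proof.
apply: vfieldP => f; apply: cinfP => p; rewrite vfield_sumE.
have [c cE] := pointwise_coordinates basis_e X p.
set A := frame_derivatives F; pose Ap := map_mx (cinf_eval p) A.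
have XF : map_mx (cinf_eval p) (\row_j X (F j)) = c *m Ap.
  by apply/rowP => j; rewrite !mxE /cinf_eval cE; apply: eq_bigr => i _; rewrite !mxE.
set k := \row_j X (F j) *m \adj A.
have kM : map_mx (cinf_eval p) k = cinf_eval p (\det A) *: c.
  by rewrite map_mxM map_mx_adj XF -mulmxA mul_mx_adj det_map_mx mul_mx_scalar.
have kE i : k 0 i p = cinf_eval p (\det A) * c 0 i.
  by have /rowP/(_ i) := kM; rewrite mxE [RHS]mxE.
transitivity (cinf_eval p (\det A) * X f p) => //.
by rewrite cE mulr_sumr; apply: eq_bigr => i _; rewrite mulrA kE.
Qed.

End Frame.

(** * Bilinear algebra of symmetric tensors *)

Section SymmetricTensor.
Variables (R : realType) (n : nat) (M : manifold R n).
Variable g : vfield M -> vfield M -> cinf M.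
Hypothesis sym_g : symmetric_tensor g.
Implicit Types (x y z : vfield M) (f : cinf M).

Lemma tensorC x y : g x y = g y x. Proof. by case: sym_g. Qed.

Lemma tensorPl f x y z : g (f *: x + y) z = f * g x z + g y z.
Proof. by case: sym_g. Qed.

Lemma tensorDl x y z : g (x + y) z = g x z + g y z.
Proof. by have := tensorPl 1 x y z; rewrite scale1r mul1r. Qed.

Lemma tensor0l z : g 0 z = 0.
Proof. by apply: (addrI (g 0 z)); rewrite -tensorDl !addr0. Qed.

Lemma tensorZl f x z : g (f *: x) z = f * g x z.
Proof. by rewrite -[f *: x]addr0 tensorPl tensor0l addr0. Qed.

Lemma tensorNl x z : g (- x) z = - g x z.
Proof. by rewrite -scaleN1r tensorZl mulN1r. Qed.

Lemma tensorBl x y z : g (x - y) z = g x z - g y z.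
Proof. by rewrite tensorDl tensorNl. Qed.

Lemma tensorNr x z : g x (- z) = - g x z.
Proof. by rewrite tensorC tensorNl tensorC. Qed.

Lemma tensorDr x y z : g x (y + z) = g x y + g x z.
Proof. by rewrite tensorC tensorDl !(tensorC x). Qed.

Lemma tensorZr f x z : g x (f *: z) = f * g x z.
Proof. by rewrite tensorC tensorZl tensorC. Qed.

Lemma tensor_suml (I : finType) (x : I -> vfield M) z :
  g (\sum_i x i) z = \sum_i g (x i) z.
Proof.
by apply: (big_morph (g^~ z)) => [x' y'|]; [exact: tensorDl|exact: tensor0l].
Qed.

End SymmetricTensor.

(** * Nondegeneracy and expansion in an orthonormal frame *)

Section OrthonormalFrame.
Variables (R : realType) (n : nat) (G : lieGroup R n).
Variables (m : nat) (e : 'I_m -> vfield G).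
Variables (g : vfield G -> vfield G -> cinf G) (eps : 'I_m -> cinf G).
Hypothesis basis_e : lie_algebra_basis e.
Hypothesis sym_g : symmetric_tensor g.
Hypothesis epsK : forall i, eps i * eps i = 1.
Hypothesis gE : forall i j, g (e i) (e j) = if i == j then eps i else 0.

Lemma tensor_sum_frame (k : 'I_m -> cinf G) j :
  g (\sum_i k i *: e i) (e j) = k j * eps j.
Proof.
rewrite tensor_suml // (bigD1 j) //= big1 => [|i ij].
  by rewrite addr0 tensorZl // gE eqxx.
by rewrite tensorZl // gE (negPf ij) mulr0.
Qed.

(** Unlike [x] so far, [D *: x] is known to be a C^oo(G)-combination of the frame, so orthogonality
    kills its coefficients; since [D p] is nonzero, [x] vanishes at [p]. *)
Lemma tensor_nondegenerate x : (forall i, g x (e i) = 0) -> x = 0.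
Proof.
move=> gx0; apply: vfieldP => f; apply: cinfP => p.
have [F] := locally_dual_functions basis_e p.
rewrite unitmxE det_map_mx unitfE; set D := \det _ => Dp.
suff Dx : D *: x = 0.
  have /eqP : (D *: x) f p = 0 by rewrite Dx.
  by rewrite mulf_eq0 (negPf Dp) => /eqP.
have := cramer_coordinates basis_e x F; rewrite -/D.
set k := (_ *m _) => DxE; rewrite DxE; apply: big1 => i _.
have : g (D *: x) (e i) = 0 by rewrite tensorZl // gx0 mulr0.
rewrite DxE tensor_sum_frame => k0.
by rewrite -[k 0 i]mulr1 -(epsK i) mulrA k0 mul0r scale0r.
Qed.

Lemma frame_expansion x : x = \sum_i (g x (e i) * eps i) *: e i.
Proof.
apply/eqP; rewrite -subr_eq0; apply/eqP/tensor_nondegenerate => i.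
by rewrite tensorBl // tensor_sum_frame -mulrA epsK mulr1 subrr.
Qed.

End OrthonormalFrame.

(** * Brackets, derivatives of constants and Koszul's formula *)

Lemma lie_bracketC (R : realType) n (M : manifold R n) (x y : vfield M) :
  lie_bracket y x = - lie_bracket x y.
Proof. by apply: vfieldP => f; rewrite /= opprB. Qed.

Lemma lie_bracketxx (R : realType) n (M : manifold R n) (x : vfield M) :
  lie_bracket x x = 0.
Proof. by apply: vfieldP => f; exact: subrr. Qed.

(** Cancels the factor 2 with which Koszul's formula gives the connection. *)
Lemma cinf_double_inj (R : realType) n (M : manifold R n) (f h : cinf M) :
  f + f = h + h -> f = h.
Proof.
move=> fh; apply: cinfP => p; have /(congr1 (cinf_eval p)) := fh.
rewrite !rmorphD /= -!mulr2n => /eqP.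
by rewrite eqrMn2r /= => /eqP.
Qed.

Lemma vfieldZ (R : realType) n (M : manifold R n) (x : vfield M) (a : R) f :
  x (a *: f) = a *: x f.
Proof.
have x0 : x 0 = 0.
  by have := vf_linear x (-1) 0 0; rewrite scaler0 addr0 scaleN1r addNr.
by have := vf_linear x a f 0; rewrite x0 !addr0.
Qed.

Lemma vfield_cst (R : realType) n (M : manifold R n) (x : vfield M) (a : R) :
  x (a *: (1 : cinf M)) = 0.
Proof.
rewrite vfieldZ; suff -> : x 1 = 0 by rewrite scaler0.
by apply: (addrI (x 1)); have := vf_leibniz x 1 1; rewrite !mulr1 mul1r addr0.
Qed.

Section Koszul.
Variables (R : realType) (n : nat) (M : manifold R n).
Variables (g : vfield M -> vfield M -> cinf M).
Variable nabla : vfield M -> vfield M -> vfield M.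
Hypothesis sym_g : symmetric_tensor g.
Hypothesis lc : levi_civita g nabla.

Lemma koszul x y z :
  g (nabla x y) z + g (nabla x y) z =
  x (g y z) + y (g x z) - z (g x y)
  + g (lie_bracket x y) z - g (lie_bracket x z) y - g (lie_bracket y z) x.
Proof.
have [_ tors met] := lc.
rewrite -!tors !met !tensorBl // ![g _ (nabla _ _)]tensorC //.
ring.
Qed.

End Koszul.

Lemma forall_ord4 (P : 'I_4 -> Prop) : P 0 -> P 1 -> P 2 -> P 3 -> forall i, P i.
Proof.
move=> P0 P1 P2 P3 [[|[|[|[|//]]]] lt_i4].
- by congr P: P0; exact: val_inj.
- by congr P: P1; exact: val_inj.
- by congr P: P2; exact: val_inj.
- by congr P: P3; exact: val_inj.
Qed.

(** * The neutral frame and its Levi-Civita connection *)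

Section NeutralFrame.
Variables (R : realType) (G : lieGroup R 4) (e1 e2 e3 e4 : vfield G).
Variables (g : vfield G -> vfield G -> cinf G).
Variable nabla : vfield G -> vfield G -> vfield G.
Local Notation e := (frame e1 e2 e3 e4).
Hypothesis basis_e : lie_algebra_basis e.
Hypothesis metric_g : standard_metric e1 e2 e3 e4 g.

(** The ring is a parameter because the Gram matrix needs the signature in [R] and frame expansions
    need it in C^oo(G). *)
Definition neutral_sign (A : pzRingType) (i : 'I_4) : A :=
  if (i < 2)%N then 1 else -1.

Let sym_g : symmetric_tensor g. Proof. by case: metric_g. Qed.
Local Notation eps := (neutral_sign (cinf G)).

Lemma neutral_signK (A : pzRingType) i : neutral_sign A i * neutral_sign A i = 1.
Proof. by rewrite /neutral_sign; case: ifP; rewrite ?mulrNN mulr1. Qed.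

Lemma metric_frame i j : g (e i) (e j) = if i == j then eps i else 0.
Proof.
have frameE k : e k = \sum_i (i == k)%:R *: e i.
  by rewrite (bigD1 k) //= eqxx scale1r big1 ?addr0 // => l /negPf ->; rewrite scale0r.
rewrite [e i]frameE [e j]frameE; case: metric_g => _ ->.
elim/forall_ord4: i; elim/forall_ord4: j; rewrite /neutral_sign /=; ring.
Qed.

Let epsK := neutral_signK (cinf G).

Lemma metric_nondegenerate x : (forall i, g x (e i) = 0) -> x = 0.
Proof. exact: (tensor_nondegenerate basis_e sym_g epsK metric_frame). Qed.

(** By [frame_expansion], identities that are C^oo-linear in a vector field need checking on the
    frame only. *)
Lemma frame_ind (P : vfield G -> Prop) :
  (forall f x y, P x -> P y -> P (f *: x + y)) -> (forall i, P (e i)) ->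
  forall x, P x.
Proof.
move=> lin Pe x; have P0 : P 0.
  by have := lin (-1) _ _ (Pe 0) (Pe 0); rewrite scaleN1r addNr.
rewrite (frame_expansion basis_e sym_g epsK metric_frame x).
by elim/big_rec: _ => // i y _; exact: lin.
Qed.

Lemma parseval x y :
  g x y = g x e1 * g e1 y + g x e2 * g e2 y - g x e3 * g e3 y - g x e4 * g e4 y.
Proof.
rewrite {1}(frame_expansion basis_e sym_g epsK metric_frame x) tensor_suml //.
rewrite 4!big_ord_recl big_ord0 !tensorZl // /frame !(tnth_nth 0) /neutral_sign /=.
ring.
Qed.

Lemma metric_adjoint (J : {linear vfield G -> vfield G}) (s : cinf G) :
  (forall i j, g (J (e i)) (e j) = s * g (e i) (J (e j))) ->
  forall x y, g (J x) y = s * g x (J y).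
Proof.
move=> adjJ x y; elim/frame_ind: x => [f x x' adjx adjx'|i].
  by rewrite linearP !tensorPl // adjx adjx'; ring.
elim/frame_ind: y => [f y y' adjy adjy'|//].
by rewrite linearP !(tensorDr, tensorZr) // adjy adjy'; ring.
Qed.

Lemma linear_square (J : {linear vfield G -> vfield G}) :
  (forall i, J (J (e i)) = - e i) -> forall x, J (J x) = - x.
Proof.
move=> JJ; elim/frame_ind => // f x y Jx Jy.
by rewrite !linearP Jx Jy.
Qed.

Lemma thetaE J z : theta e g nabla J z =
  Ften g nabla J e1 e1 z + Ften g nabla J e2 e2 z
  - Ften g nabla J e3 e3 z - Ften g nabla J e4 e4 z.
Proof.
pose d := \row_i neutral_sign R i.
have gramE : gram e g = diag_mx d.
  apply/matrixP => i j; rewrite !mxE metric_frame.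
  by rewrite /neutral_sign; case: eqP; case: ifP.
(* A Gram matrix with square 1 is its own inverse, so [theta] becomes a signed sum. *)
have gram2 : gram e g *m gram e g = 1%:M.
  rewrite gramE mulmx_diag -diag_const_mx; congr diag_mx.
  by apply/rowP => i; rewrite !mxE neutral_signK.
have [_ ugram] := mulmx1_unit gram2.
have invE : invmx (gram e g) = diag_mx d.
  by rewrite -[LHS]mulmx1 -gram2 mulKmx // gramE.
rewrite /theta invE; transitivity (\sum_i d 0 i *: Ften g nabla J (e i) (e i) z).
  apply: eq_bigr => i _; rewrite (bigD1 i) //= big1 => [|j /negPf ji].
    by rewrite !mxE eqxx addr0.
  by rewrite !mxE eq_sym ji scale0r.
rewrite 4!big_ord_recl big_ord0 !mxE /frame !(tnth_nth 0) /neutral_sign /=.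
by rewrite !scale1r !scaleN1r addr0 !addrA.
Qed.

Lemma vfield_metric_frame (x : vfield G) i j : x (g (e i) (e j)) = 0.
Proof.
have -> : g (e i) (e j) = (if i == j then neutral_sign R i else 0) *: (1 : cinf G).
  rewrite metric_frame /neutral_sign; case: (i == j); last by rewrite scale0r.
  by case: ifP => _; [rewrite scale1r|rewrite scaleN1r].
exact: vfield_cst.
Qed.

Lemma metric_frame4 i : g e4 (e i) = if i == 3 then -1 else 0.
Proof.
by rewrite -[e4]/(e 3) metric_frame eq_sym; elim/forall_ord4: i.
Qed.

(** Packs the six relations into one formula. It is confined to the frame: the right side is
    C^oo-bilinear, the bracket is not. *)
Lemma bracket_frame i j :
  lie_bracket e4 e1 = e1 -> lie_bracket e4 e2 = e2 -> lie_bracket e4 e3 = e3 ->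
  lie_bracket e1 e2 = 0 -> lie_bracket e1 e3 = 0 -> lie_bracket e2 e3 = 0 ->
  lie_bracket (e i) (e j) = g e4 (e j) *: e i - g e4 (e i) *: e j.
Proof.
move=> b41 b42 b43 b12 b13 b23; pose bE := (b41, b42, b43, b12, b13, b23).
rewrite !metric_frame4; elim/forall_ord4: i; elim/forall_ord4: j;
  by rewrite /frame !(tnth_nth 0) /= ?lie_bracketxx ?bE 1?lie_bracketC ?bE
    ?scale0r ?scaleN1r ?subr0 ?sub0r ?opprK ?oppr0 ?addNr.
Qed.

Hypothesis bracketE : forall i j,
  lie_bracket (e i) (e j) = g e4 (e j) *: e i - g e4 (e i) *: e j.
Hypothesis lc_nabla : levi_civita g nabla.

(** A predicate on [y], because the Leibniz rule excludes the formula for arbitrary [y]. For [x],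
    [y] orthogonal to [e4] it gives [- g x y *: e4], a totally umbilic second fundamental form. *)
Definition umbilic (y : vfield G) := forall x, nabla x y = g e4 y *: x - g x y *: e4.

Lemma umbilicN y : umbilic y -> umbilic (- y).
Proof.
have [[_ _ nablaM] _ _] := lc_nabla.
move=> uy x; have := nablaM (-1) x y; rewrite scaleN1r => ->.
have -> : x (-1) = 0 by rewrite -[-1](scaleN1r (1 : cinf G)) vfield_cst.
by rewrite scale0r add0r uy !tensorNr // scaleN1r !scaleNr opprD.
Qed.

(** Both sides are C^oo-linear in [x], so [x] may be taken in the frame and the result tested
    against each [e k]. All metric coefficients are then constant, and only the bracket terms of
    Koszul's formula survive. *)
Lemma umbilic_frame j : umbilic (e j).
Proof.
have [[nablaP _ _] _ _] := lc_nabla.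
move=> x; elim/frame_ind: x => [f x y nx ny|i].
  rewrite nablaP nx ny tensorPl // scalerBr !scalerDr scalerDl !scalerA.
  by rewrite opprD addrACA [f * g e4 _]mulrC.
apply/eqP; rewrite -subr_eq0; apply/eqP/metric_nondegenerate => k.
apply: cinf_double_inj; rewrite addr0 !(tensorBl, tensorZl) //.
rewrite [LHS](_ : _ = g (nabla (e i) (e j)) (e k) + g (nabla (e i) (e j)) (e k)
  - (g e4 (e j) * g (e i) (e k) - g (e i) (e j) * g e4 (e k)) *+ 2); last ring.
rewrite (koszul sym_g lc_nabla) !vfield_metric_frame !bracketE.
rewrite !(tensorBl, tensorZl) // !(tensorC sym_g (e k)) !(tensorC sym_g (e j) (e i)).
ring.
Qed.

(** * Fundamental tensor, form [theta] and classes of one structure [J] *)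

Section Structure.
Variables (J : {linear vfield G -> vfield G}) (s : cinf G).
Hypothesis sK : s * s = 1.
Hypothesis adjJ_frame : forall i j, g (J (e i)) (e j) = s * g (e i) (J (e j)).
Hypothesis JJ_frame : forall i, J (J (e i)) = - e i.
Hypothesis umbilicJ : forall i, umbilic (J (e i)).
Hypothesis diagJ : forall i, g (e i) (J (e i)) = 0.

Let adjJ := metric_adjoint adjJ_frame.

(** The terms in [x f] cancel between [nabla x (J y)] and [J (nabla x y)], so [F] is C^oo-linear in
    [y]; on the frame the connection formula applies to both [y] and [J y]. *)
Lemma Ften_umbilic x y z : Ften g nabla J x y z =
  g e4 (J y) * g x z - g x (J y) * g e4 z - g e4 y * g (J x) z
  + g x y * g (J e4) z.
Proof.
have [[_ nablaD nablaM] _ _] := lc_nabla.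
elim/frame_ind: y => [f y y' Fy Fy'|i].
  rewrite [LHS](_ : _ = f * Ften g nabla J x y z + Ften g nabla J x y' z).
    rewrite Fy Fy' linearP !tensorDr  // !tensorZr //; ring.
  rewrite /Ften linearP !nablaD !nablaM !linearD !linearZ /=.
  rewrite !(tensorDl, tensorNl, tensorZl) //; ring.
rewrite /Ften umbilicJ umbilic_frame linearB !linearZ /=.
rewrite !(tensorDl, tensorNl, tensorZl) //; ring.
Qed.

(** Tracing the four terms of [Ften_umbilic] gives [s], 0, -1 and 4 times [g (J e4) z]: by
    adjointness and [parseval], by [diagJ], by orthogonality to [e4], and by the dimension. *)
Lemma theta_umbilic z : theta e g nabla J z = (3 + s) * g (J e4) z.
Proof.
rewrite thetaE !Ften_umbilic.
have adj4 i : g e4 (J (e i)) = s * g (J e4) (e i).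
  by rewrite adjJ mulrA sK mul1r.
have := (adj4 0, adj4 1, adj4 2, adj4 3).
have := (diagJ 0, diagJ 1, diagJ 2, diagJ 3).
have := (metric_frame4 0, metric_frame4 1, metric_frame4 2, metric_frame4 3).
have := (metric_frame 0 0, metric_frame 1 1, metric_frame 2 2, metric_frame 3 3).
rewrite /frame !(tnth_nth 0) /neutral_sign /= => gd g4 dJ aJ.
rewrite (parseval (J e4) z) (tensorC sym_g (J e4) e4) !dJ !aJ !g4 !gd; ring.
Qed.

Let gJ4J z : g (J e4) (J z) = - (s * g e4 z).
Proof. by rewrite adjJ (linear_square JJ_frame) tensorNr // mulrN. Qed.

Lemma class_W4_umbilic : s = -1 -> class_W4 e g nabla J.
Proof.
move=> s1 x y z; rewrite Ften_umbilic !theta_umbilic !gJ4J !adjJ s1.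
(* Here [3 + s] is 2, which the factor 1/2 of the class cancels. *)
set F := LHS; rewrite [X in _ *: X](_ : _ = F *+ 2); last by rewrite /F; ring.
by rewrite -[F *+ _](@scaler_nat R) scalerA mulVf ?scale1r // pnatr_eq0.
Qed.

Lemma class_W1_umbilic : s = 1 -> class_W1 e g nabla J.
Proof.
move=> s1 x y z; rewrite Ften_umbilic !theta_umbilic !gJ4J !adjJ s1.
(* Here [3 + s] is 4, which the factor 1/4 of the class cancels. *)
set F := LHS; rewrite [X in _ *: X](_ : _ = F *+ 4); last by rewrite /F; ring.
by rewrite -[F *+ _](@scaler_nat R) scalerA mulVf ?scale1r // pnatr_eq0.
Qed.

Lemma theta_comp_closed : s = -1 ->
  forall x y, dform (theta e g nabla J \o J) x y = 0.
Proof.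
have [_ tors met] := lc_nabla.
have umb4 x : nabla x e4 = g e4 e4 *: x - g x e4 *: e4.
  exact: (umbilic_frame 3).
move=> s1 x y; have thJ z : (theta e g nabla J \o J) z = g e4 z + g e4 z.
  by rewrite /= theta_umbilic gJ4J s1; ring.
have vfD (w : vfield G) (f h : cinf G) : w (f + h) = w f + w h.
  by have := vf_linear w 1 f h; rewrite !scale1r.
(* Metricity and zero torsion reduce the differential to twice
   [g (nabla x e4) y - g (nabla y e4) x]. *)
rewrite /dform !thJ !vfD !met -tors !umb4 !(tensorBl, tensorZl, tensorNr, tensorDr) //.
rewrite (tensorC sym_g x e4) (tensorC sym_g y e4) (tensorC sym_g y x); ring.
Qed.

End Structure.

End NeutralFrame.

(** * The frame conditions for the three structures *)

Theorem proposition2p5 (R : realType) (G : lieGroup R 4)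
    (e1 e2 e3 e4 : vfield G)
    (g : vfield G -> vfield G -> cinf G)
    (nabla : vfield G -> vfield G -> vfield G)
    (J1 J2 J3 : {linear vfield G -> vfield G}) :
  simply_connected R G ->
  lie_algebra_basis (frame e1 e2 e3 e4) ->
  lie_bracket e4 e1 = e1 ->
  lie_bracket e4 e2 = e2 ->
  lie_bracket e4 e3 = e3 ->
  lie_bracket e1 e2 = 0 ->
  lie_bracket e1 e3 = 0 ->
  lie_bracket e2 e3 = 0 ->
  standard_J1 e1 e2 e3 e4 J1 ->
  standard_J2 e1 e2 e3 e4 J2 ->
  standard_J3 e1 e2 e3 e4 J3 ->
  standard_metric e1 e2 e3 e4 g ->
  levi_civita g nabla ->
  class_W0 (frame e1 e2 e3 e4) g nabla J1 J2 J3.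
Proof.
set e := frame e1 e2 e3 e4.
move=> _ basis_e b41 b42 b43 b12 b13 b23 HJ1 HJ2 HJ3 metric_g lc.
have sym_g : symmetric_tensor g by case: metric_g.
have bE i j := bracket_frame metric_g i j b41 b42 b43 b12 b13 b23.
have umb := umbilic_frame basis_e metric_g bE lc.
(* Each structure permutes the frame up to sign, so [umb] and [umbN] cover all [J (e i)]. *)
have umbN i := umbilicN metric_g lc (umb i).
have gE := (tensorNl sym_g, tensorNr sym_g, metric_frame metric_g).
have N1K : (-1 : cinf G) * -1 = 1 by rewrite mulrNN mulr1.
have one1 : (1 : cinf G) * 1 = 1 by rewrite mulr1.
have J1E : (J1 (e 0) = e 1) * (J1 (e 1) = - e 0) * (J1 (e 2) = - e 3) *
  (J1 (e 3) = e 2) by case: HJ1.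
have J2E : (J2 (e 0) = e 2) * (J2 (e 1) = e 3) * (J2 (e 2) = - e 0) *
  (J2 (e 3) = - e 1) by case: HJ2.
have J3E : (J3 (e 0) = - e 3) * (J3 (e 1) = e 2) * (J3 (e 2) = - e 1) *
  (J3 (e 3) = e 0) by case: HJ3.
(* An isometry with square -1 is skew-adjoint, hence [s = -1]; the anti-isometries [J2] and [J3] are
   self-adjoint, hence [s = 1]. *)
have J1adj i j : g (J1 (e i)) (e j) = -1 * g (e i) (J1 (e j)).
  by elim/forall_ord4: i; elim/forall_ord4: j;
    rewrite !J1E !gE /neutral_sign /= !(mulN1r, mul1r, opprK, oppr0).
have J2adj i j : g (J2 (e i)) (e j) = 1 * g (e i) (J2 (e j)).
  by elim/forall_ord4: i; elim/forall_ord4: j;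
    rewrite !J2E !gE /neutral_sign /= !(mulN1r, mul1r, opprK, oppr0).
have J3adj i j : g (J3 (e i)) (e j) = 1 * g (e i) (J3 (e j)).
  by elim/forall_ord4: i; elim/forall_ord4: j;
    rewrite !J3E !gE /neutral_sign /= !(mulN1r, mul1r, opprK, oppr0).
have J1J1 i : J1 (J1 (e i)) = - e i.
  by elim/forall_ord4: i; rewrite !J1E ?linearN ?J1E.
have J2J2 i : J2 (J2 (e i)) = - e i.
  by elim/forall_ord4: i; rewrite !J2E ?linearN ?J2E.
have J3J3 i : J3 (J3 (e i)) = - e i.
  by elim/forall_ord4: i; rewrite !J3E ?linearN ?J3E.
have J1umb i : umbilic e4 g nabla (J1 (e i)) by elim/forall_ord4: i; rewrite J1E.
have J2umb i : umbilic e4 g nabla (J2 (e i)) by elim/forall_ord4: i; rewrite J2E.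
have J3umb i : umbilic e4 g nabla (J3 (e i)) by elim/forall_ord4: i; rewrite J3E.
have J1diag i : g (e i) (J1 (e i)) = 0.
  by elim/forall_ord4: i; rewrite J1E !gE /= ?oppr0.
have J2diag i : g (e i) (J2 (e i)) = 0.
  by elim/forall_ord4: i; rewrite J2E !gE /= ?oppr0.
have J3diag i : g (e i) (J3 (e i)) = 0.
  by elim/forall_ord4: i; rewrite J3E !gE /= ?oppr0.
split; first split.
- exact: (class_W4_umbilic basis_e metric_g bE lc N1K J1adj J1J1 J1umb J1diag).
- exact: (class_W1_umbilic basis_e metric_g bE lc one1 J2adj J2J2 J2umb J2diag).
- exact: (class_W1_umbilic basis_e metric_g bE lc one1 J3adj J3J3 J3umb J3diag).
- exact: (theta_comp_closed basis_e metric_g bE lc N1K J1adj J1J1 J1umb J1diag).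
Qed.
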